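(* Let $\gamma, M\in(0,\infty)$ and $\delta,\tau\ge 0$. Assume $$\mathbf v \in \mathcal R^M := \{ \mathbf v : \|\hat{\boldsymbol\alpha}(\mathbf v)\| < M \};$$ let $\mathbf v^\delta\in\mathbb R^n$ satisfy $\|\mathbf v^\delta-\mathbf v\|\le\delta$; and let $\boldsymbol\alpha\in\mathbb R^n$ satisfy $$\|\hat{\mathbf v}(\boldsymbol\alpha) - \mathbf v^\delta + \gamma\boldsymbol\alpha\| \le \tau .$$ Then $$\|\hat{\mathbf v}(\boldsymbol\alpha)-\mathbf v\| \le 2\delta + M\gamma + 2\tau .$$
   Context: Setting. Let $V \subseteq \mathbb R^d$ be the velocity domain and write $\langle g\rangle := \int_V g(v)\,dv$. Let $\mathbf m(v) = (m_0(v),\dots,m_{n-1}(v))$ be a vector of real-valued (linearly independent) basis functions on $V$. Let $\eta : D \to \mathbb R$, $D\subseteq\mathbb R$, be a strictly convex, twice continuously differentiable kinetic entropy density, and let $\eta_*$ be its Legendre dual, $\eta_*(y) = \sup_{z\in D}\{yz-\eta(z)\}$. Let $\mathbb F(V) = \{g \in L^1(V) : \mathrm{Range}(g)\subseteq D\}$. $\|\cdot\|$ is the Euclidean norm on $\mathbb R^n$. For $\boldsymbol\alpha\in\mathbb R^n$ put $G_{\boldsymbol\alpha} := \eta_*'(\boldsymbol\alpha\cdot\mathbf m)$ and $\hat{\mathbf v}(\boldsymbol\alpha) := \langle \mathbf m\, G_{\boldsymbol\alpha}\rangle$ (whenever these are defined and finite; in particular this is understood for the $\boldsymbol\alpha$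 in the claim). Original problem: minimize $\langle\eta(g)\rangle$ over $g\in\mathbb F(V)$ subject to $\langle \mathbf m g\rangle = \mathbf v$. Its dual solution is $$\hat{\boldsymbol\alpha}(\mathbf v) := \operatorname{argmax}_{\boldsymbol\alpha\in\mathbb R^n}\{\boldsymbol\alpha\cdot\mathbf v - \langle \eta_*(\boldsymbol\alpha\cdot\mathbf m)\rangle\}.$$ Standing assumption. For $\mathbf v\in\mathcal R^M$ the original problem has a solution, namely $G_{\hat{\boldsymbol\alpha}(\mathbf v)}$, so that $\hat{\mathbf v}(\hat{\boldsymbol\alpha}(\mathbf v)) = \mathbf v$ (i.e. $\hat{\mathbf v}$ is the inverse of $\hat{\boldsymbol\alpha}$). *)

(* Defs.v *)
From HB Require Import structures.
From mathcomp Require Import all_boot all_order all_algebra.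
From mathcomp Require Import all_classical all_reals all_analysis.
From mathcomp Require Import measurable_realfun.

Set Implicit Arguments.
Unset Strict Implicit.
Unset Printing Implicit Defensive.

Import Order.TTheory GRing.Theory Num.Theory.
Import numFieldNormedType.Exports.

Local Open Scope classical_set_scope.
Local Open Scope ring_scope.

(* R^d as d-tuples of reals, with the Borel sigma-algebra (generated by the
   coordinate maps). *)
Notation Rtuple R d := (d.-tuple (measurableTypeR R)).

Definition tuple_cons {T : Type} (n : nat) (p : T * n.-tuple T) :
  n.+1.-tuple T := [tuple of p.1 :: p.2].

Section cons_measure.
Context (R : realType) (n : nat).
Variable mu : {sigma_finite_measure set (Rtuple R n) -> \bar R}.

Lemma measurable_tuple_cons :
  measurable_fun setT (@tuple_cons (measurableTypeR R) n).
Proof. exact: (measurable_cons measurable_fst measurable_snd). Qed.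

Definition cons_measure : set (Rtuple R n.+1) -> \bar R :=
  pushforward (@lebesgue_measure R \x mu)%E
    (@tuple_cons (measurableTypeR R) n).

HB.instance Definition _ := Measure.copy cons_measure
  (measure_function_pushforward__canonical__measure_function_Measure
     (@lebesgue_measure R \x mu)%E measurable_tuple_cons).

Lemma cons_measure_sigma_finite : sigma_finite setT cons_measure.
Proof.
have [F FT Foo] : sigma_finite setT (@lebesgue_measure R \x mu)%E.
  have /sigma_finiteP[F [TF ndF Foo]] := sigma_finiteT (@lebesgue_measure R).
  have /sigma_finiteP[G [TG ndG Goo]] := sigma_finiteT mu.
  exists (fun k => F k `*` G k).
    rewrite -setXTT TF TG; apply/seteqP; split => -[x y].
      move=> [/= [i _ Fx] [j _ Gy]]; exists (maxn i j) => //; split.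
        by move: x Fx; exact/subsetPset/ndF/leq_maxl.
      by move: y Gy; exact/subsetPset/ndG/leq_maxr.
    by move=> [i _ []/= ? ?]; split; exists i.
  move=> k; have [mF Fk] := Foo k; have [mG Gk] := Goo k.
  split; first exact: measurableX.
  by rewrite product_measure1E// lte_mul_pinfty// ge0_fin_numE.
pose g (t : Rtuple R n.+1) : measurableTypeR R * Rtuple R n :=
  (tnth t ord0, [tuple of behead t]).
have mg : measurable_fun setT g.
  apply/measurable_fun_pair; first exact: measurable_tnth.
  exact: measurable_behead.
have gK : cancel (@tuple_cons (measurableTypeR R) n) g.
  by move=> [x t]; congr pair; apply/val_inj.
exists (fun i => g @^-1` F i).
  by rewrite -preimage_bigcup -FT preimage_setT.
move=> i; have [mF Fi] := Foo i; split.
  by rewrite -[X in measurable X]setTI; exact: mg.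
rewrite /cons_measure /pushforward.
by rewrite (_ : _ @^-1` _ = F i)// -comp_preimage; apply/seteqP; split => x;
  rewrite /preimage/= gK.
Qed.

HB.instance Definition _ := @Measure_isSigmaFinite.Build _ _ _
  cons_measure cons_measure_sigma_finite.

End cons_measure.

Fixpoint lebesgue_tuple (R : realType) (d : nat) :
    {sigma_finite_measure set (Rtuple R d) -> \bar R} :=
  match d return {sigma_finite_measure set (Rtuple R d) -> \bar R} with
  | 0 => @dirac _ (Rtuple R 0) [tuple] R
  | d'.+1 => cons_measure (lebesgue_tuple R d')
  end.

Lemma lebesgue_tuple_box (R : realType) (d : nat)
    (A : 'I_d -> set (measurableTypeR R)) :
  (forall i, measurable (A i)) ->
  lebesgue_tuple R d [set x | forall i, A i (tnth x i)] =
    (\prod_(i < d) lebesgue_measure (A i))%E.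
Proof.
elim: d A => [|d IH] A mA.
  rewrite big_ord0 /= diracE mem_set//=.
  by case.
rewrite big_ord_recl -(IH (fun i => A (lift ord0 i)))//.
rewrite /= /cons_measure /pushforward -product_measure1E//; last first.
  have -> : [set x : Rtuple R d | forall i, A (lift ord0 i) (tnth x i)] =
      \bigcap_(i in [set: 'I_d]) ((@tnth _ _ ^~ i) @^-1` A (lift ord0 i)).
    by apply/seteqP; split => x /= Ax i; [move=> _|]; exact: Ax.
  apply: fin_bigcap_measurable => // i _.
  by rewrite -[X in measurable X]setTI; exact: measurable_tnth.
congr (_ _); apply/seteqP; split => [[x t] Axt|[x t] [/= Ax At] i] /=.
  split=> /= [|i]; first exact: (Axt ord0).
  by have := Axt (lift ord0 i); rewrite tnthS.
by case: (unliftP ord0 i) => [j|] ->; rewrite /= ?tnthS.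
Qed.

Section euclidean.
Context (R : realType) (n : nat).

Definition dotr (a b : 'rV[R]_n) : R := \sum_(i < n) a ord0 i * b ord0 i.

(* The library norm `|a| on 'rV[R]_n is the sup norm. *)
Definition enorm (a : 'rV[R]_n) : R := Num.sqrt (dotr a a).

End euclidean.

(* eta is a total function of which only the values on D matter.  D may contain
   its endpoints (e.g. D = [0, +oo[ for z ln z - z), hence eta is required to be
   continuous on D and twice continuously differentiable in its interior. *)
Definition kinetic_entropy (R : realType) (D : set R) (eta : R -> R) : Prop :=
  [/\ is_interval D,
      (forall x y t, D x -> D y -> x != y -> 0 < t < 1 ->
        eta (t * x + (1 - t) * y) < t * eta x + (1 - t) * eta y),
      {within D, continuous eta} &
      (forall x, D° x -> [/\ derivable eta x 1, derivable (derive1 eta) x 1 &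
        {for x, continuous (derive1 (derive1 eta))}])].

Section legendre.
Context (R : realType) (D : set R) (eta : R -> R).

Definition legendre (y : R) : \bar R :=
  ereal_sup [set (y * z - eta z)%:E | z in D].

(* The derivative of eta_* makes sense only where eta_* is finite nearby. *)
Definition legendre_derivable (y : R) : Prop :=
  (\forall z \near y, legendre z \is a fin_num) /\
  derivable (fine \o legendre) y 1.

Definition legendre' : R -> R := derive1 (fine \o legendre).

End legendre.

Section moments.
Context (R : realType) (d n : nat).
Variables (V : set (Rtuple R d)) (m : Rtuple R d -> 'rV[R]_n).
Variables (D : set R) (eta : R -> R).

Local Notation mu := (lebesgue_tuple R d).

Definition linearly_independent : Prop :=
  forall c : 'rV[R]_n, (forall x, V x -> dotr c (m x) = 0) -> c = 0.

(* The integral of f over V is meaningful, possibly infinite (the library's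
   integral is total and gives a junk value to oo - oo). *)
Definition integral_defined (f : Rtuple R d -> \bar R) : Prop :=
  measurable_fun V f /\
  (\int[mu]_(x in V) f^\+ x < +oo \/ \int[mu]_(x in V) f^\- x < +oo)%E.

Definition moments_finite (g : Rtuple R d -> R) : Prop :=
  forall i, mu.-integrable V (fun x => (m x ord0 i * g x)%:E).

Definition moments (g : Rtuple R d -> R) : 'rV[R]_n :=
  \row_i \int[mu]_(x in V) (m x ord0 i * g x).

Definition ansatz (alpha : 'rV[R]_n) (x : Rtuple R d) : R :=
  legendre' D eta (dotr alpha (m x)).

Definition ansatz_defined (alpha : 'rV[R]_n) : Prop :=
  {ae mu, forall x, V x -> legendre_derivable D eta (dotr alpha (m x))}.

Definition vhat (alpha : 'rV[R]_n) : 'rV[R]_n := moments (ansatz alpha).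

Definition vhat_defined (alpha : 'rV[R]_n) : Prop :=
  ansatz_defined alpha /\ moments_finite (ansatz alpha).

Definition feasible (v : 'rV[R]_n) (g : Rtuple R d -> R) : Prop :=
  [/\ mu.-integrable V (EFin \o g), {ae mu, forall x, V x -> D (g x)},
      moments_finite g & moments g = v].

Definition primal_solution (v : 'rV[R]_n) (g : Rtuple R d -> R) : Prop :=
  [/\ feasible v g, mu.-integrable V (fun x => (eta (g x))%:E) &
      forall h, feasible v h -> integral_defined (fun x => (eta (h x))%:E) ->
        (\int[mu]_(x in V) (eta (g x))%:E <=
         \int[mu]_(x in V) (eta (h x))%:E)%E].

Definition dual_objective (v alpha : 'rV[R]_n) : \bar R :=
  ((dotr alpha v)%:E - \int[mu]_(x in V) legendre D eta (dotr alpha (m x)))%E.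

Definition dual_argmax (v : 'rV[R]_n) : set 'rV[R]_n :=
  [set beta | mu.-integrable V (fun x => legendre D eta (dotr beta (m x))) /\
    forall alpha,
      integral_defined (fun x => legendre D eta (dotr alpha (m x))) ->
      (dual_objective v alpha <= dual_objective v beta)%E].

(* A point of the argmax, meaningful only if the latter is nonempty. *)
Definition alphahat (v : 'rV[R]_n) : 'rV[R]_n := xget 0 (dual_argmax v).

Definition calRM (M : R) : set 'rV[R]_n :=
  [set v | dual_argmax v !=set0 /\ enorm (alphahat v) < M].

(* In particular vhat (alphahat v) = v, by feasibility. *)
Definition dual_solves_primal (M : R) : Prop :=
  forall v, calRM M v -> ansatz_defined (alphahat v) /\
    primal_solution v (ansatz (alphahat v)).

End moments.

(* Main.v *)
Require Import Defs.
From HB Require Import structures.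
From mathcomp Require Import all_boot all_order all_algebra.
From mathcomp Require Import all_classical all_reals all_analysis.
From mathcomp Require Import measurable_realfun.
From mathcomp Require Import lra.

Set Implicit Arguments.
Unset Strict Implicit.
Unset Printing Implicit Defensive.

Import Order.TTheory GRing.Theory Num.Theory.
Import numFieldNormedType.Exports.

Local Open Scope classical_set_scope.
Local Open Scope ring_scope.

(** The argument is the one that proves stability of Tikhonov regularisation
    for a monotone operator.  Write w for the moment vector of the ansatz at
    alpha and beta for the dual solution at v, so that v is the moment vector
    of the ansatz at beta.

    The Legendre dual is a supremum of affine functions, hence convex, and its
    derivative is nondecreasing ([legendre'_monotone]).  Applying this pointwise
    at [dotr alpha (m x)] and [dotr beta (m x)] and integrating over the
    velocity domain shows that the moment map is monotone
    ([vhat_monotone]):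
      0 <= (alpha - beta) . (w - v).

    By hypothesis, gamma alpha = r + e - (w - v), where the residual r has norm
    at most tau and the data error e = vdelta - v has norm at most delta.
    Multiplying the monotonicity inequality by gamma and substituting gives
      |w - v|^2 <= (w - v) . (r + e - gamma beta)
                <= |w - v| (tau + delta + gamma M)
    by Cauchy-Schwarz ([dotr_le_enorm]) and |beta| < M.  Dividing by |w - v|
    bounds it by delta + M gamma + tau, which is below the stated bound. *)

(** * The Euclidean inner product *)

Section euclidean_theory.
Context (R : realType) (n : nat).
Implicit Types a b c : 'rV[R]_n.

Lemma dotrC a b : dotr a b = dotr b a.
Proof. by apply: eq_bigr => i _; rewrite mulrC. Qed.

Lemma dotrDr a b c : dotr a (b + c) = dotr a b + dotr a c.
Proof. by rewrite -big_split; apply: eq_bigr => i _; rewrite mxE mulrDr. Qed.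

Lemma dotrZr k a b : dotr a (k *: b) = k * dotr a b.
Proof. by rewrite mulr_sumr; apply: eq_bigr => i _; rewrite mxE mulrCA. Qed.

Lemma dotrNr a b : dotr a (- b) = - dotr a b.
Proof. by rewrite -scaleN1r dotrZr mulN1r. Qed.

Lemma dotrBl a b c : dotr (a - b) c = dotr a c - dotr b c.
Proof. by rewrite dotrC dotrDr dotrNr !(dotrC c). Qed.

Lemma dotrr_ge0 a : 0 <= dotr a a.
Proof. by apply: sumr_ge0 => i _; rewrite -expr2 sqr_ge0. Qed.

Lemma enorm_ge0 a : 0 <= enorm a.
Proof. exact: sqrtr_ge0. Qed.

Lemma sqr_enorm a : enorm a ^+ 2 = dotr a a.
Proof. by rewrite sqr_sqrtr// dotrr_ge0. Qed.

Lemma enormN a : enorm (- a) = enorm a.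
Proof. by rewrite /enorm dotrNr dotrC dotrNr opprK. Qed.

Lemma enorm0_eq0 a : enorm a = 0 -> a = 0.
Proof.
move=> a0; have /eqP := sqr_enorm a.
rewrite a0 expr0n/= eq_sym psumr_eq0 => [/allP a_0|i _]; last first.
  by rewrite -expr2 sqr_ge0.
apply/rowP => i; rewrite mxE; apply/eqP.
by have := a_0 i (mem_index_enum i); rewrite /= mulf_eq0 orbb.
Qed.

(** Cauchy-Schwarz, from the nonnegativity of the squared norm of
    |b| a - |a| b, which equals 2 |a| |b| (|a| |b| - a . b). *)
Lemma dotr_le_enorm a b : dotr a b <= enorm a * enorm b.
Proof.
have dotr0 c : dotr c 0 = 0 by rewrite -(scale0r 0) dotrZr mul0r.
have [/enorm0_eq0 ->|a0] := eqVneq (enorm a) 0.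
  by rewrite dotrC dotr0 mulr_ge0// enorm_ge0.
have [/enorm0_eq0 ->|b0] := eqVneq (enorm b) 0.
  by rewrite dotr0 mulr_ge0// enorm_ge0.
have ab_gt0 : 0 < enorm a * enorm b by rewrite mulr_gt0// lt0r ?a0 ?b0 enorm_ge0.
have := dotrr_ge0 (enorm b *: a - enorm a *: b).
rewrite dotrBl !dotrDr !dotrNr !dotrZr !(dotrC (_ *: _)).
rewrite !dotrZr (dotrC b a) -!sqr_enorm => le0.
rewrite -(ler_pM2l ab_gt0); nra.
Qed.

End euclidean_theory.

(** * Monotonicity of the derivative of the Legendre dual *)

(** The upper half of convexity along a segment suffices: dividing by t,
    f b - f a bounds the difference quotients of f at a in the direction b - a
    with step t, and these tend to the left-hand side. *)
Lemma derive1_le_chord (R : realType) (f : R -> R) (a b : R) :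
  derivable f a 1 ->
  (forall t : R, 0 < t < 1 -> f (t * (b - a) + a) <= f a + t * (f b - f a)) ->
  (b - a) * derive1 f a <= f b - f a.
Proof.
move=> /derivable1_diffP df conv.
have -> : (b - a) * derive1 f a = 'D_(b - a) f a.
  by rewrite (deriveE _ df) (diff1E df).
have /cvg_dnbhs_at_right quot : derivable f a (b - a) by exact: diff_derivable.
apply: (cvgr_to_le quot); near=> t.
have t0 : 0 < t by near: t; exact: nbhs_right_gt.
have t1 : t < 1 by near: t; exact: nbhs_right_lt.
rewrite -[leLHS]/(t^-1 * (f (t * (b - a) + a) - f a)).
by rewrite ler_pdivrMl// lerBlDl conv// t0.
Unshelve. all: by end_near. Qed.

Section legendre_theory.
Context (R : realType) (D : set R) (eta : R -> R).

Lemma legendre_ge (y z : R) : D z ->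
  ((y * z - eta z)%:E <= legendre D eta y)%E.
Proof. by move=> Dz; apply: ereal_sup_ubound; exists z. Qed.

(** A supremum of affine functions lies below its chords. *)
Lemma legendre_chord (y1 y2 t : R) :
  legendre D eta y1 \is a fin_num -> legendre D eta y2 \is a fin_num ->
  0 < t < 1 ->
  fine (legendre D eta (t * (y2 - y1) + y1)) <=
    fine (legendre D eta y1) +
      t * (fine (legendre D eta y2) - fine (legendre D eta y1)).
Proof.
move=> fin1 fin2 /andP[t0 t1].
set c := leRHS.
have le_c : (legendre D eta (t * (y2 - y1) + y1) <= c%:E)%E.
  apply: ge_ereal_sup => _ [z Dz <-]; rewrite lee_fin /c.
  have := legendre_ge y1 Dz; have := legendre_ge y2 Dz.
  rewrite -{1}(fineK fin1) -{1}(fineK fin2) !lee_fin; nra.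
(* Finiteness at y1 makes D nonempty, which excludes the value -oo, whose real
   part would be the junk value 0. *)
have [z Dz] : D !=set0.
  apply/set0P/eqP => D0; move: fin1.
  by rewrite /legendre D0 image_set0 ereal_sup0.
have := legendre_ge (t * (y2 - y1) + y1) Dz.
by case: (legendre _ _ _) le_c => [r| |]; rewrite ?lee_fin.
Qed.

(** Adding the two chord inequalities, at y1 towards y2 and at y2 towards y1,
    cancels the values of the dual and leaves the derivatives. *)
Lemma legendre'_monotone (y1 y2 : R) :
  legendre_derivable D eta y1 -> legendre_derivable D eta y2 ->
  0 <= (y1 - y2) * (legendre' D eta y1 - legendre' D eta y2).
Proof.
move=> [/nbhs_singleton fin1 d1] [/nbhs_singleton fin2 d2].
have := derive1_le_chord d1 (fun t => legendre_chord fin1 fin2).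
have := derive1_le_chord d2 (fun t => legendre_chord fin2 fin1).
rewrite /legendre' /=; nra.
Qed.

End legendre_theory.

(** * Monotonicity of the moment map *)

Section Rintegral_theory.
Context d (T : measurableType d) (R : realType).
Variables (mu : {measure set T -> \bar R}) (D : set T).
Hypothesis mD : measurable D.

(** The integrand agrees almost everywhere with its absolute value. *)
Lemma Rintegral_ae_ge0 (f : T -> R) : mu.-integrable D (EFin \o f) ->
  {ae mu, forall x, D x -> 0 <= f x} -> 0 <= \int[mu]_(x in D) f x.
Proof.
move=> intf f0; have mf := measurable_int _ intf.
rewrite /Rintegral (@ae_eq_integral _ _ _ _ _ (fun x => `|(f x)%:E|)%E)//.
- by apply/fine_ge0/integral_ge0 => x _; exact: abse_ge0.
- exact: measurableT_comp.
- by apply: filterS f0 => x f0 Dx /=; rewrite ger0_norm// f0.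
Qed.

Lemma Rintegral_sum (I : Type) (s : seq I) (f : I -> T -> R) :
  (forall i, mu.-integrable D (EFin \o f i)) ->
  \int[mu]_(x in D) (\sum_(i <- s) f i x) =
  \sum_(i <- s) \int[mu]_(x in D) f i x.
Proof.
move=> intf; rewrite /Rintegral; under eq_integral do rewrite -sumEFin.
rewrite integral_sum//.
rewrite (eq_bigr (fun i => (\int[mu]_(x in D) f i x)%R%:E)) ?sumEFin// => i _.
by rewrite fineK//; exact: integrable_fin_num (intf i).
Qed.

End Rintegral_theory.

Section moments_theory.
Context (R : realType) (d n : nat).
Variables (V : set (Rtuple R d)) (m : Rtuple R d -> 'rV[R]_n).
Hypothesis mV : measurable V.
Local Notation mu := (lebesgue_tuple R d).

Lemma moments_finiteB (g h : Rtuple R d -> R) :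
  moments_finite V m g -> moments_finite V m h ->
  moments_finite V m (fun x => g x - h x).
Proof.
move=> mg mh i; apply: eq_integrable (integrableB mV (mg i) (mh i)) => //.
by move=> x _; rewrite /= -EFinB mulrBr.
Qed.

Lemma momentsB (g h : Rtuple R d -> R) :
  moments_finite V m g -> moments_finite V m h ->
  moments V m (fun x => g x - h x) = moments V m g - moments V m h.
Proof.
move=> mg mh; apply/rowP => i; rewrite !mxE -RintegralB//.
  by apply: eq_Rintegral => x _; rewrite mulrBr.
by apply: eq_integrable (mg i).
by apply: eq_integrable (mh i).
Qed.

(** By linearity, c . <m g> = <(c . m) g>, an integral of a function that is
    nonnegative almost everywhere. *)
Lemma dotr_moments_ge0 (c : 'rV[R]_n) (g : Rtuple R d -> R) :
  moments_finite V m g -> {ae mu, forall x, V x -> 0 <= dotr c (m x) * g x} ->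
  0 <= dotr c (moments V m g).
Proof.
move=> mg ge0; pose f (i : 'I_n) x := c ord0 i * (m x ord0 i * g x).
have intf i : mu.-integrable V (EFin \o f i).
  by apply: eq_integrable (integrableZl mV (c ord0 i) (mg i)).
have fE x : \sum_(i < n) f i x = dotr c (m x) * g x.
  by rewrite mulr_suml; apply: eq_bigr => i _; rewrite /f mulrA.
have -> : dotr c (moments V m g) = \int[mu]_(x in V) \sum_(i < n) f i x.
  rewrite Rintegral_sum//; apply: eq_bigr => i _.
  by rewrite mxE RintegralZl//; exact: mg.
apply: Rintegral_ae_ge0 => //.
  apply: eq_integrable (integrable_sum mV _ (fun i _ => intf i)) => //.
  by move=> x _; rewrite /= sumEFin.
by apply: filterS ge0 => x ge0 Vx; rewrite fE ge0.
Qed.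

(** At almost every x in V the derivative of the dual is monotone between
    alpha . m(x) and beta . m(x), and (alpha - beta) . m(x) is the difference
    of these two arguments. *)
Lemma vhat_monotone (D : set R) (eta : R -> R) (alpha beta : 'rV[R]_n) :
  vhat_defined V m D eta alpha -> vhat_defined V m D eta beta ->
  0 <= dotr (alpha - beta) (vhat V m D eta alpha - vhat V m D eta beta).
Proof.
move=> [da fa] [db fb]; rewrite -momentsB//.
apply: dotr_moments_ge0; first exact: moments_finiteB.
apply: filterS2 da db => x da db Vx.
by rewrite dotrBl; apply: legendre'_monotone; [exact: da|exact: db].
Qed.

End moments_theory.

Theorem mainTheorem2 (R : realType) (d n : nat) (V : set (Rtuple R d))
    (m : Rtuple R d -> 'rV[R]_n) (D : set R) (eta : R -> R)
    (gamma M delta tau : R) (v vdelta alpha : 'rV[R]_n)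
    (mV : measurable V)
    (mm : forall i, measurable_fun V (fun x => m x ord0 i))
    (m_indep : linearly_independent V m)
    (eta_entropy : kinetic_entropy D eta)
    (gamma_gt0 : 0 < gamma) (M_gt0 : 0 < M)
    (delta_ge0 : 0 <= delta) (tau_ge0 : 0 <= tau)
    (standing : dual_solves_primal V m D eta M)
    (vRM : calRM V m D eta M v)
    (v_vdelta : enorm (vdelta - v) <= delta)
    (vhat_alpha : vhat_defined V m D eta alpha)
    (alpha_tau :
      enorm (vhat V m D eta alpha - vdelta + gamma *: alpha) <= tau) :
  enorm (vhat V m D eta alpha - v) <= 2 * delta + M * gamma + 2 * tau.
Proof.
have [_ beta_M] := vRM; set beta := alphahat V m D eta v in beta_M.
have [dbeta [[_ _ fbeta vbeta] _ _]] := standing _ vRM.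
have := vhat_monotone mV vhat_alpha (conj dbeta fbeta).
rewrite /vhat vbeta -/(vhat V m D eta alpha) -/beta.
move: (vhat V m D eta alpha) alpha_tau => w alpha_tau mono.
set r := w - vdelta + gamma *: alpha in alpha_tau.
have := dotr_le_enorm (w - v) r; have := dotr_le_enorm (w - v) (vdelta - v).
have := dotr_le_enorm (w - v) (- beta); rewrite enormN dotrNr.
have -> : dotr (w - v) r = dotr (w - v) (w - v) - dotr (w - v) (vdelta - v) +
    gamma * dotr (w - v) alpha.
  by rewrite -dotrZr -dotrNr -!dotrDr /r opprB addrA subrK.
move: mono; rewrite dotrC dotrDr dotrNr -sqr_enorm.
move: (enorm_ge0 (w - v)) (enorm_ge0 beta).
move: (enorm (w - v)) (dotr _ alpha) (dotr _ beta) (dotr _ (vdelta - v)) => N A B E.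
move=> N0 b0 mono leB leE ler.
have N2 : N ^+ 2 <= N * (delta + M * gamma + tau).
  have : gamma * - B <= gamma * (N * M).
    by rewrite ler_pM2l//; apply: le_trans leB _; rewrite ler_wpM2l// ltW.
  have : N * enorm (vdelta - v) <= N * delta by rewrite ler_wpM2l.
  have : N * enorm r <= N * tau by rewrite ler_wpM2l.
  have : 0 <= gamma * (A - B) by rewrite mulr_ge0// ltW.
  by move: leE ler; lra.
have bound_ge0 : 0 <= M * gamma by rewrite mulr_ge0// ltW.
have : N <= delta + M * gamma + tau.
  have [->|N_neq0] := eqVneq N 0; first by lra.
  by move: N2; rewrite expr2 ler_pM2l// lt0r N_neq0.
lra.
Qed.
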